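(* Let $\Bbbk$ be a field and let $A$ be a finite-dimensional self-injective $\Bbbk$-algebra. Then there exists an injective coassociative $A$-bimodule morphism $\Delta: A\to A\otimes A$.
   Context: Algebras are unital, associative and finite-dimensional over a fixed field $\Bbbk$; $\otimes=\otimes_{\Bbbk}$. An algebra $A$ is self-injective if it is injective as a left and as a right $A$-module. The $A$-bimodule structure on $A\otimes A$ is $a(b\otimes c)d=ab\otimes cd$. Coassociativity of $\Delta$ means $(\Delta\otimes\mathrm{id})\circ\Delta=(\mathrm{id}\otimes\Delta)\circ\Delta$ as maps $A\to A\otimes A\otimes A$. No counit is required. *)

(* Defs.v *)
From HB Require Import structures.
From mathcomp Require Import all_boot all_order all_algebra all_field.

Set Implicit Arguments.
Unset Strict Implicit.
Unset Printing Implicit Defensive.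

Import GRing.Theory.
Local Open Scope ring_scope.

Reserved Notation "U ⊗ V" (at level 40, left associativity).

(* Modules range over all (not only finite-dimensional) left R-modules. *)
Definition injective_module (R : pzRingType) (E : lmodType R) : Prop :=
  forall (M N : lmodType R) (i : {linear M -> N}) (f : {linear M -> E}),
    injective i -> exists g : {linear N -> E}, forall x, g (i x) = f x.

(* Right R-modules are left modules over the converse ring R^c. *)
Definition self_injective (R : pzRingType) : Prop :=
  injective_module (R^o : lmodType R)
  /\ injective_module ((R^c)^o : lmodType R^c).

(* The tensor product of finite-dimensional spaces, modelled by matrices of
   coordinates: entry (i, j) is the coefficient of e_i ⊗ e'_j, where e and e'
   are the library's bases of U and V.  The lemmas below give the universal
   property, which determines it up to a unique isomorphism. *)
Definition tensor (k : fieldType) (U V : vectType k) :=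
  'M[k]_(\dim {:U}, \dim {:V}).

HB.instance Definition _ (k : fieldType) (U V : vectType k) :=
  Vector.copy (tensor U V) 'M[k]_(\dim {:U}, \dim {:V}).

Notation "U ⊗ V" := (tensor U%type V%type) : type_scope.

Section Tensor.
Variable k : fieldType.
Implicit Types U V W : vectType k.

Definition tens U V (u : U) (v : V) : U ⊗ V :=
  \matrix_(i, j) (coord (vbasis {:U}) i u * coord (vbasis {:V}) j v).

Local Notation "u ⊗ v" := (tens u v) : ring_scope.

Local Notation is_bilinear f := (bilinear_for *:%R *:%R f).

Lemma tens_bilinear U V : is_bilinear (@tens U V).
Proof.
split=> [v a x y|u a x y]; apply/matrixP => i j; rewrite !mxE linearP.
  by rewrite mulrDl mulrA.
by rewrite mulrDr mulrCA.
Qed.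

HB.instance Definition _ U V :=
  bilinear_isBilinear.Build k U V (U ⊗ V)%type _ _ (@tens U V)
    (@tens_bilinear U V).

Definition tlift U V W (f : U -> V -> W) (t : U ⊗ V) : W :=
  \sum_i \sum_j (t : 'M_(_, _)) i j *: f (vbasis {:U})`_i (vbasis {:V})`_j.

Lemma tlift_linear U V W (f : U -> V -> W) : linear (tlift f).
Proof.
move=> a s t; rewrite /tlift scaler_sumr -big_split; apply: eq_bigr => i _ /=.
rewrite scaler_sumr -big_split; apply: eq_bigr => j _ /=.
by rewrite !mxE scalerDl scalerA.
Qed.

HB.instance Definition _ U V W (f : U -> V -> W) :=
  GRing.isLinear.Build k (U ⊗ V)%type W _ (tlift f) (@tlift_linear U V W f).

Lemma bilinear_sum U V W (f : U -> V -> W) : is_bilinear f -> forall u v,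
  f u v = \sum_i \sum_j (coord (vbasis {:U}) i u * coord (vbasis {:V}) j v)
            *: f (vbasis {:U})`_i (vbasis {:V})`_j.
Proof.
move=> fB u v; pose g := bilinear_isBilinear.Build k U V W _ _ f fB.
pose h : {bilinear U -> V -> W} := HB.pack f g.
rewrite {1}(coord_vbasis (memvf u)) {1}(coord_vbasis (memvf v)) -/(h _ _).
rewrite -[LHS]/(h _ _) linear_sumlz; apply: eq_bigr => i _.
rewrite linearZl_LR linear_sumr scaler_sumr; apply: eq_bigr => j _.
by rewrite linearZr_LR scalerA.
Qed.

Lemma tliftE U V W (f : U -> V -> W) :
  is_bilinear f -> forall u v, tlift f (u ⊗ v) = f u v.
Proof.
move=> fB u v; rewrite (bilinear_sum fB) /tlift.
by apply: eq_bigr => i _; apply: eq_bigr => j _; rewrite mxE.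
Qed.

Lemma tensor_sum U V (t : U ⊗ V) :
  t = \sum_i \sum_j (t : 'M_(_, _)) i j *: ((vbasis {:U})`_i ⊗ (vbasis {:V})`_j).
Proof.
apply/matrixP => i j; rewrite summxE (bigD1 i) //= summxE (bigD1 j) //=.
have fb X : free (vbasis {:X : vectType k}) by exact: basis_free (vbasisP _).
rewrite !mxE !coord_free ?fb // !eqxx !mulr1 !big1 ?addr0 // => [i' ni|j' nj].
  rewrite summxE big1 // => j' _.
  by rewrite !mxE !coord_free ?fb // (negPf ni) mul0r mulr0.
by rewrite !mxE !coord_free ?fb // (negPf nj) !mulr0.
Qed.

Lemma tensor_ext U V W (g h : {linear (U ⊗ V)%type -> W}) :
  (forall u v, g (u ⊗ v) = h (u ⊗ v)) -> g =1 h.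
Proof.
move=> gh t; rewrite (tensor_sum t) !linear_sum; apply: eq_bigr => i _.
by rewrite !linear_sum; apply: eq_bigr => j _; rewrite !linearZ gh.
Qed.

Definition tmap U V U' V' (f : U -> U') (g : V -> V') : U ⊗ V -> U' ⊗ V' :=
  tlift (fun u v => f u ⊗ g v).

Lemma tmapE U V U' V' (f : {linear U -> U'}) (g : {linear V -> V'}) u v :
  tmap f g (u ⊗ v) = f u ⊗ g v.
Proof.
rewrite /tmap tliftE //; split=> [y|x] a b c /=.
  by rewrite linearP linearPl.
by rewrite linearP linearPr.
Qed.

Definition tassoc U V W : (U ⊗ V) ⊗ W -> U ⊗ (V ⊗ W) :=
  tlift (fun (t : U ⊗ V) w => tlift (fun u v => u ⊗ (v ⊗ w)) t).

Lemma tassocE U V W (u : U) (v : V) (w : W) :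
  tassoc ((u ⊗ v) ⊗ w) = u ⊗ (v ⊗ w).
Proof.
have Bw (z : W) : is_bilinear (fun (x : U) (y : V) => x ⊗ (y ⊗ z)).
  split=> [y|x] a b c /=; first by rewrite linearPl.
  by rewrite linearPl linearPr.
rewrite /tassoc tliftE ?tliftE //; split=> [z|t] a b c /=.
  exact: linearP.
rewrite /tlift scaler_sumr -big_split; apply: eq_bigr => i _ /=.
rewrite scaler_sumr -big_split; apply: eq_bigr => j _ /=.
by rewrite !linearPr scalerDr !scalerA mulrC.
Qed.

End Tensor.

Notation "u ⊗ v" := (tens u v) : ring_scope.

Section Bimodule.
Variables (k : fieldType) (A : falgType k).

Definition tens_lact (a : A) (t : A ⊗ A) : A ⊗ A :=
  tmap (fun b : A => a * b) (@idfun A) t.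

Definition tens_ract (t : A ⊗ A) (d : A) : A ⊗ A :=
  tmap (@idfun A) (fun c : A => c * d) t.

Lemma tens_bimodE (a b c d : A) :
  tens_ract (tens_lact a (b ⊗ c)) d = (a * b) ⊗ (c * d).
Proof.
rewrite /tens_lact (tmapE (GRing.mull_fun a idfun) idfun) /=.
by rewrite /tens_ract (tmapE idfun (GRing.mulr_fun d idfun)).
Qed.

Definition bimodule_morphism (Delta : {linear A -> (A ⊗ A)%type}) : Prop :=
  forall a b d : A, Delta (a * b * d) = tens_ract (tens_lact a (Delta b)) d.

Definition coassociative (Delta : {linear A -> (A ⊗ A)%type}) : Prop :=
  forall a : A,
    tassoc (tmap Delta (@idfun A) (Delta a))
    = tmap (@idfun A) Delta (Delta a).

End Bimodule.

(* Main.v *)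
(* Coassociativity is automatic for a bimodule morphism Delta.  Such maps
   correspond to left module morphisms phi from the dual DA of A to A, by
   Delta a = sum_i a phi(e_i^* ) ⊗ e_i for a basis (e_i), and Delta is injective
   if and only if the image of phi is faithful.  Since A is left injective, it is
   a direct summand of a power of DA, that is, 1 is a sum of elements phi_i(f_i).
   To get a single phi with faithful image, split off a summand Ae common to A
   and DA of maximal dimension: a nonzero idempotent in (1-e)A(1-e) factoring
   through the complement of Ae in DA would enlarge Ae, so every endomorphism of
   A(1-e) factoring through that complement lies in the radical.  Hence A(1-e)
   is a summand of a power of Ae, and Ae is faithful. *)
Require Import Defs.
From HB Require Import structures.
From mathcomp Require Import all_boot all_order all_algebra all_field.
From mathcomp Require Import ring.
From Stdlib Require Import Classical.

Set Implicit Arguments.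
Unset Strict Implicit.
Unset Printing Implicit Defensive.

Import GRing.Theory.
Local Open Scope ring_scope.

Section FiniteDimensionalAlgebra.
Variables (k : fieldType) (A : falgType k).
Implicit Types (a b c e x y : A) (p : {poly k}).

(** * Fitting decomposition of an element, and the Jacobson radical *)

Lemma horner_algZ x (r : k) p : horner_alg x (r *: p) = r *: horner_alg x p.
Proof. by rewrite -mul_polyC rmorphM /= horner_algC mulr_algl. Qed.

Lemma exists_annihilating_poly x : exists2 p, p != 0 & horner_alg x p = 0.
Proof.
pose n := \dim {:A}.
have lin : linear (fun v : 'rV[k]_n.+1 => horner_alg x (rVpoly v)).
  by move=> r u v; rewrite linearP rmorphD /= horner_algZ.
pose L := GRing.isLinear.Build k 'rV[k]_n.+1 A *:%R _ lin.
pose f : {linear 'rV[k]_n.+1 -> A} :=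
  HB.pack (fun v => horner_alg x (rVpoly v)) L.
have : lker (linfun f) != 0%VS.
  apply/eqP=> ker0; have := limg_ker_dim (linfun f) fullv.
  rewrite ker0 capv0 dimv0 add0n dimvf /dim /= mul1n => dimf.
  by have := dimvS (subvf (limg (linfun f))); rewrite dimf ltnn.
rewrite -vpick0; set v := vpick _ => v0; exists (rVpoly v).
  by apply: contraNneq v0 => pv0; rewrite -[v]rVpolyK pv0 linear0.
by have := memv_pick (lker (linfun f)); rewrite memv_ker lfunE => /eqP.
Qed.

(** Fitting's lemma in [k[x]]: if [q * 'X^m] kills [x] with [q] prime to ['X], the Bezout term
    [u * 'X^(m.+1)] evaluates to an idempotent, which vanishes only for nilpotent [x]. *)
Lemma nilpotent_or_idempotent x :
  (exists n, x ^+ n = 0)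
  \/ exists c, [/\ c * x != 0, c * x * (c * x) = c * x & c * x = x * c].
Proof.
have [p p0 px] := exists_annihilating_poly x.
have [m [q]] := multiplicity_XsubC p 0; rewrite p0 subr0 /= => q0 pE.
(* The exponent [m.+1] leaves a factor [x] in the idempotent even when [m = 0]. *)
have /Bezout_eq1_coprimepP[[u v] /= uv1] : coprimep 'X^(m.+1) q.
  by rewrite coprimep_expl // coprimep_sym coprimepX.
pose h : {rmorphism {poly k} -> A} := horner_alg x.
have hX n : h 'X^n = x ^+ n by rewrite rmorphXn /= /h horner_algX.
pose c := h (u * 'X^m).
have cx : c * x = h (u * 'X^(m.+1)).
  by rewrite exprSr mulrA [RHS]rmorphM /= /h horner_algX.
have xc : x * c = c * x.
  by rewrite cx exprS mulrCA [RHS]rmorphM /= /h horner_algX.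
have cx1 : 1 - c * x = h (v * q).
  by rewrite cx -(rmorph1 h) -rmorphB /= -uv1 addrC addKr.
have [cx0|cx0] := eqVneq (c * x) 0; [left | right].
  exists m.+1; rewrite -[LHS]mulr1 -[1](subr0) -cx0 cx1 -hX -rmorphM /=.
  have -> : 'X^(m.+1) * (v * q) = 'X * v * p by rewrite pE exprS; ring.
  by rewrite rmorphM /= [h p]px mulr0.
exists c; split=> //; apply/eqP; rewrite eq_sym -subr_eq0.
rewrite -{1}[c * x]mulr1 -mulrBr cx1 cx -rmorphM /=.
have -> : u * 'X^(m.+1) * (v * q) = u * 'X * v * p by rewrite pE exprS; ring.
by rewrite rmorphM /= [h p]px mulr0.
Qed.

(* Membership of [x] in the Jacobson radical. *)
Definition quasi_regular x := forall b, exists c, (1 - b * x) * c = 1.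

Lemma quasi_regular0 : quasi_regular 0.
Proof. by move=> b; exists 1; rewrite mulr0 subr0 mulr1. Qed.

Lemma quasi_regularD x y :
  quasi_regular x -> quasi_regular y -> quasi_regular (x + y).
Proof.
move=> Nx Ny b; have [c cE] := Nx b; have [d dE] := Ny (c * b).
exists (d * c); rewrite mulrDr opprD addrA.
suff -> : 1 - b * x - b * y = (1 - b * x) * (1 - c * b * y).
  by rewrite mulrA -(mulrA _ _ d) dE mulr1.
by rewrite mulrBr mulr1 !mulrA cE mul1r.
Qed.

Lemma nilpotent_subr1_rinv x n : x ^+ n = 0 -> exists c, (1 - x) * c = 1.
Proof.
move=> xn0; exists (\sum_(i < n) x ^+ i).
by rewrite -opprB mulNr -subrX1 xn0 sub0r opprK.
Qed.

(** * Homomorphisms from a module to [A] with faithful image *)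

Section FaithfulHom.
Variable M : lmodType A.
Implicit Types (phi psi : {linear M -> A^o}) (m q : M).

Definition right_comb phi psi a b (x : M) : A^o :=
  (phi x : A) * a + (psi x : A) * b.

Lemma right_comb_is_linear phi psi a b : linear (right_comb phi psi a b).
Proof.
move=> c x y; rewrite /right_comb !linearP /= /GRing.scale /= !mulrDl -!mulrA.
by rewrite addrACA -mulrDr.
Qed.

HB.instance Definition _ phi psi a b :=
  GRing.isLinear.Build A M A^o _ (right_comb phi psi a b)
    (right_comb_is_linear phi psi a b).

(* The summand [A e] of [A], for [e = phi m], splits off [M]: [phi] maps [M] onto
   [A e], and [a |-> a *: m] is a section. *)
Definition split_by phi m :=
  [/\ (phi m : A) * phi m = phi m, (phi m : A) *: m = m
    & forall x : M, (phi x : A) * phi m = phi x].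

Lemma split_by_extend phi m psi q e :
    split_by phi m -> phi q = 0 -> psi q = e -> e != 0 -> e * e = e ->
    e * phi m = 0 -> (phi m : A) * e = 0 ->
  exists phi' m', split_by phi' m' /\
    (\dim (limg (amulr (phi m : A))) < \dim (limg (amulr (phi' m' : A))))%N.
Proof.
set f : A := phi m => -[ff fm phif] phiq psiq e0 ee ef fe.
pose c : A := psi m.
(* The term [c * e] keeps [phi' m = f]: it cancels [psi m * e], as [f * c = c] follows from
   [f *: m = m]. *)
pose phi' : {linear M -> A^o} := right_comb phi psi (1 - c * e) e.
have phi'E (x : M) : (phi' x : A) = phi x * (1 - c * e) + psi x * e by [].
have phi'm : phi' (m + e *: q) = f + e.
  rewrite phi'E !linearD !linearZ /= phiq psiq scaler0 addr0 -/f -/c.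
  rewrite /GRing.scale /= mulrBr mulr1 !mulrDl ee ee.
  have -> : f * (c * e) = c * e by rewrite mulrA /c -[in RHS]fm linearZ.
  by rewrite addrA subrK.
exists phi', (m + e *: q); rewrite phi'm; split; first split.
- by rewrite phi'm mulrDl !mulrDr ff ee ef fe addr0 add0r.
- rewrite phi'm scalerDl !scalerDr fm !scalerA fe ee scale0r addr0.
  by rewrite -[in X in _ + (X + _)]fm scalerA ef scale0r add0r.
- move=> x; have phie : (phi x : A) * e = 0 by rewrite -phif -mulrA fe mulr0.
  rewrite phi'm phi'E mulrDr !mulrBr !mulr1 !mulrDl !mulNr phif -!mulrA ee ef.
  by rewrite phie !mulr0 subr0 addr0 add0r addrA.
(* [A f] is strictly smaller than [A (f + e)]: the latter contains [e], and [e = a * f] would give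
   [e = e * e = a * f * e = 0]. *)
rewrite (ltn_leqif (dimv_leqif_sup _)).
  apply/negP=> /subvP/(_ e)/(_ _)/memv_imgP[].
    by apply/memv_imgP; exists e; rewrite ?memvf // lfunE /= mulrDr ef ee add0r.
  move=> a _; rewrite lfunE /= => eE; move/eqP: e0; apply.
  by rewrite -ee {1}eE -mulrA fe mulr0.
apply/subvP=> _ /memv_imgP[a _ ->]; apply/memv_imgP; exists (a * f).
  exact: memvf.
by rewrite !lfunE /= -mulrA mulrDr ff fe addr0.
Qed.

(** Otherwise, with [f = phi m], some multiple of this element yields a nonzero idempotent of
    [(1 - f) A (1 - f)] factoring through [q], and [split_by_extend] contradicts maximality. *)
Lemma split_by_max_quasi_regular phi m psi q :
    split_by phi m ->
    (forall phi' m', split_by phi' m' ->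
      (\dim (limg (amulr (phi' m' : A))) <= \dim (limg (amulr (phi m : A))))%N) ->
    phi q = 0 ->
  quasi_regular ((1 - phi m) * psi q * (1 - phi m)).
Proof.
set f : A := phi m => sphi max phiq; have [ff _ _] := sphi.
set x := _ * _ * _ => b.
have ff1 : (1 - f) * (1 - f) = 1 - f.
  by rewrite mulrBr mulr1 mulrBl mul1r ff subrr subr0.
have xf1 : x * (1 - f) = x by rewrite /x -mulrA ff1.
have [[n yn0]|[c [e0 ee ce]]] := nilpotent_or_idempotent ((1 - f) * b * x).
  apply: (@nilpotent_subr1_rinv _ n.+1).
  suff -> i : (b * x) ^+ i.+1 = b * x * ((1 - f) * b * x) ^+ i.
    by rewrite yn0 mulr0.
  elim: i => [|i IHi]; first by rewrite mulr1.
  rewrite exprS IHi [in RHS]exprS !mulrA.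
  by rewrite -[in RHS](mulrA _ (1 - f) (1 - f)) ff1.
set e := c * _ in e0 ee ce.
pose psi' : {linear M -> A^o} := right_comb psi psi (1 - f) 0.
pose q' := (c * (1 - f) * b * (1 - f)) *: q.
have f1f : (1 - f) * f = 0 by rewrite mulrBl mul1r ff subrr.
have ff1_0 : f * (1 - f) = 0 by rewrite mulrBr mulr1 ff subrr.
have [||||||phi' [m' [/max + lt]]] := @split_by_extend phi m psi' q' e sphi.
- by rewrite linearZ /= phiq scaler0.
- rewrite linearZ /= /right_comb mulr0 addr0 /GRing.scale /=.
  by rewrite /e /x !mulrA.
- by [].
- by [].
- by rewrite -/f /e -!mulrA f1f !mulr0.
- by rewrite -/f ce !mulrA ff1_0 !mul0r.
by rewrite leqNgt lt.
Qed.

(* Take [e = phi m] idempotent of maximal rank.  If [a] kills the image of [phi],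
   cutting [1 = \sum_i chi_i (g_i)] down by [1 - e] gives [a = a * j] with [j]
   in the Jacobson radical. *)
Lemma generator_faithful_hom n
    (chi : 'I_n -> {linear M -> A^o}) (g : 'I_n -> M) :
    \sum_i (chi i (g i) : A) = 1 ->
  exists phi, forall a, (forall x : M, a * phi x = 0) -> a = 0.
Proof.
move=> chi1; apply: NNPP => no_phi.
(* If no [phi] is faithful, the rank can always be increased, eventually beyond [\dim A]. *)
suff /(_ (\dim {:A}).+1)[phi [m [_]]] : forall d, exists phi m,
    split_by phi m /\ (d <= \dim (limg (amulr (phi m : A))))%N.
  by rewrite leqNgt ltnS dimvS ?subvf.
elim=> [|d [phi [m [sphi dphi]]]].
  exists (\0 : {linear M -> A^o}), 0; split=> //; split=> /=.
  - by rewrite mul0r.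
  - by rewrite scaler0.
  by move=> x; rewrite mul0r.
apply: NNPP => no_larger; apply: no_phi; exists phi => a aphi.
have max phi' m' : split_by phi' m' ->
    (\dim (limg (amulr (phi' m' : A))) <= \dim (limg (amulr (phi m : A))))%N.
  move=> sphi'; rewrite leqNgt; apply/negP=> lt; apply: no_larger.
  by exists phi', m'; split=> //; apply: leq_ltn_trans lt.
have [_ _ phif] := sphi; set f : A := phi m in phif.
(* [h i] is the projection of [g i] to the complement [ker phi] of the split summand. *)
pose h i := g i - (phi (g i) : A) *: m.
have phih i : phi (h i) = 0.
  by rewrite linearB linearZ /= /GRing.scale /= phif subrr.
pose j := \sum_i (1 - f) * chi i (h i) * (1 - f).
have qr_j : quasi_regular j.
  rewrite /j; apply: big_ind => [||i _]; first exact: quasi_regular0.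
    exact: quasi_regularD.
  exact: split_by_max_quasi_regular.
have af1 : a * (1 - f) = a by rewrite mulrBr mulr1 aphi subr0.
have ah i : a * chi i (h i) = a * chi i (g i).
  rewrite linearB linearZ /= /GRing.scale /= mulrBr.
  by rewrite (mulrA a (phi _ : A) (chi i m : A)) aphi mul0r subr0.
have aj : a * j = a.
  rewrite -[RHS]af1 -[in RHS](mulr1 a) -[X in a * X * _]chi1 mulr_sumr.
  rewrite mulr_sumr mulr_suml; apply: eq_bigr => i _.
  by rewrite !mulrA af1 ah.
have [c jc] := qr_j 1; rewrite mul1r in jc.
by rewrite -[a]mulr1 -jc mulrA mulrBr mulr1 aj subrr mul0r.
Qed.

End FaithfulHom.

(** * Coinduced modules and the dual of [A] *)

(* The left [A]-module of [k]-linear maps [A -> V], with [(a f)(y) = f (y a)]: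
   for [V = k] the dual of [A], for [V = A] the module of linear endomorphisms. *)
Definition coind (V : vectType k) := 'Hom(A, V).

HB.instance Definition _ V := GRing.Zmodule.on (coind V).

Section Coinduced.
Variable V : vectType k.
Implicit Types (f g : coind V).

Definition coind_scale a f : coind V := (f \o amulr a)%VF.

Lemma coind_scaleE a f y : coind_scale a f y = f (y * a).
Proof. by rewrite lfunE /= lfunE. Qed.

Fact coind_scaleA a b f :
  coind_scale a (coind_scale b f) = coind_scale (a * b) f.
Proof. by apply/lfunP=> y; rewrite !coind_scaleE mulrA. Qed.

Fact coind_scale1 : left_id 1 coind_scale.
Proof. by move=> f; apply/lfunP=> y; rewrite coind_scaleE mulr1. Qed.

Fact coind_scaleDr : right_distributive coind_scale +%R.
Proof.
move=> a f g; apply/lfunP=> y.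
by rewrite add_lfunE !coind_scaleE add_lfunE.
Qed.

Fact coind_scaleDl f : {morph coind_scale^~ f : a b / a + b}.
Proof.
move=> a b; apply/lfunP=> y.
by rewrite add_lfunE !coind_scaleE mulrDr linearD.
Qed.

HB.instance Definition _ := GRing.Zmodule_isLmodule.Build A (coind V)
  coind_scaleA coind_scale1 coind_scaleDr coind_scaleDl.

End Coinduced.

Definition coind_map (V W : vectType k) (h : 'Hom(V, W)) (f : coind V) : coind W :=
  (h \o f)%VF.

Lemma coind_mapE (V W : vectType k) (h : 'Hom(V, W)) (f : coind V) y :
  coind_map h f y = h (f y).
Proof. by rewrite comp_lfunE. Qed.

Fact coind_map_is_linear (V W : vectType k) (h : 'Hom(V, W)) :
  linear (coind_map h).
Proof.
move=> a f g; apply/lfunP=> y; rewrite add_lfunE coind_scaleE !coind_mapE.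
by rewrite add_lfunE coind_scaleE linearD.
Qed.

HB.instance Definition _ (V W : vectType k) (h : 'Hom(V, W)) :=
  GRing.isLinear.Build A (coind V) (coind W) _ (coind_map h)
    (coind_map_is_linear h).

(** Embeds the regular module into [coind A], a finite power of the dual; left injectivity provides
    a retraction. *)
Definition coind_amulr (a : A^o) : coind A := amulr (a : A).

Fact coind_amulr_is_linear : linear coind_amulr.
Proof.
move=> a b c; apply/lfunP=> y.
by rewrite add_lfunE coind_scaleE !lfunE /= mulrDr mulrA.
Qed.

HB.instance Definition _ :=
  GRing.isLinear.Build A A^o (coind A) _ coind_amulr coind_amulr_is_linear.

Definition dual_coord (i : 'I_(\dim {:A})) : coind k^o :=
  linfun (coord (vbasis {:A}) i : A -> k^o).

Definition scale_on (v : A) (r : k^o) : A := r *: v.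

Fact scale_on_is_linear v : linear (scale_on v).
Proof. by move=> a r s; rewrite /scale_on scalerDl scalerA. Qed.

HB.instance Definition _ v :=
  GRing.isLinear.Build k k^o A _ (scale_on v) (scale_on_is_linear v).

Lemma dual_coordE i y : dual_coord i y = coord (vbasis {:A}) i y.
Proof. by rewrite lfunE. Qed.

Lemma dual_coord_sum (f : coind k^o) :
  f = \sum_(i < \dim {:A}) in_alg A (f (vbasis {:A})`_i) *: dual_coord i.
Proof.
apply/lfunP=> y; rewrite sum_lfunE {1}(coord_vbasis (memvf y)) linear_sum.
apply: eq_bigr => i _; rewrite coind_scaleE dual_coordE /= mulr_algr !linearZ.
by rewrite /GRing.scale /= mulrC.
Qed.

Lemma injective_dual_faithful_hom :
    injective_module (A^o : lmodType A) ->
  exists phi : {linear coind k^o -> A^o},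
    forall a, (forall f, a * phi f = 0) -> a = 0.
Proof.
move=> injA.
have [|r rE] := injA _ _ coind_amulr idfun.
  by move=> a b /= /amulr_inj.
pose chi (i : 'I_(\dim {:A})) : {linear coind k^o -> A^o} :=
  r \o coind_map (linfun (scale_on (vbasis {:A})`_i)).
apply: (@generator_faithful_hom _ _ chi dual_coord).
(* Both arguments of [r] are the identity of [A], written in coordinates on the left and as
   [amulr 1] on the right. *)
rewrite /= -linear_sum -[RHS]rE; congr (r _).
apply/lfunP=> y; rewrite sum_lfunE lfunE /= mulr1 [RHS](coord_vbasis (memvf y)).
by apply: eq_bigr => i _; rewrite coind_mapE dual_coordE lfunE.
Qed.

(** * The comultiplication attached to a morphism from the dual *)

Lemma tmap_sum (U V U' V' : vectType k) (f : U -> U') (g : V -> V')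
    (I : finType) (t : I -> (U ⊗ V)%type) :
  tmap f g (\sum_i t i) = \sum_i tmap f g (t i).
Proof. exact: linear_sum. Qed.

Lemma tassoc_sum (U V W : vectType k)
    (I : finType) (t : I -> (U ⊗ V ⊗ W)%type) :
  tassoc (\sum_i t i) = \sum_i tassoc (t i).
Proof. exact: linear_sum. Qed.

Lemma tens_bimod_sum (I : finType) (x y : I -> A) a d :
  tens_ract (tens_lact a (\sum_i x i ⊗ y i)) d = \sum_i (a * x i) ⊗ (y i * d).
Proof.
rewrite /tens_lact /tens_ract !tmap_sum.
by apply: eq_bigr => i _; apply: tens_bimodE.
Qed.

Section Comultiplication.
Variable phi : {linear coind k^o -> A^o}.
Local Notation basis := (vbasis {:A}).

Definition comul (a : A) : (A ⊗ A)%type :=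
  \sum_(i < \dim {:A}) (a * phi (dual_coord i)) ⊗ basis`_i.

Fact comul_is_linear : linear comul.
Proof.
move=> r a b; rewrite /comul scaler_sumr -big_split; apply: eq_bigr => i _ /=.
by rewrite mulrDl -scalerAl linearPl.
Qed.

HB.instance Definition _ :=
  GRing.isLinear.Build k A (A ⊗ A)%type _ comul comul_is_linear.

Lemma comul_right a :
  comul a = \sum_(i < \dim {:A}) (phi (dual_coord i) : A) ⊗ (basis`_i * a).
Proof.
have xE (i : 'I_(\dim {:A})) :
    a * phi (dual_coord i)
    = \sum_(j < \dim {:A})
        coord basis i (basis`_j * a) *: (phi (dual_coord j) : A).
  rewrite -[LHS]/(a *: phi (dual_coord i)) -linearZ [X in phi X]dual_coord_sum.
  rewrite linear_sum; apply: eq_bigr => j _.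
  by rewrite linearZ coind_scaleE dual_coordE; apply: mulr_algl.
under eq_bigr => j _ do
  rewrite (coord_vbasis (memvf (basis`_j * a))) linear_sumr.
rewrite exchange_big; apply: eq_bigr => i _ /=; rewrite xE linear_sumlz.
by apply: eq_bigr => j _; rewrite linearZl_LR linearZr_LR.
Qed.

Lemma comul_bimodule : bimodule_morphism comul.
Proof.
move=> a b d /=; have comulE c : comul c =
  \sum_(i < \dim {:A}) (c * phi (dual_coord i)) ⊗ basis`_i by [].
rewrite [in RHS]comulE tens_bimod_sum.
(* Left linearity comes from the definition, right linearity from [comul_right]. *)
transitivity (tens_ract (tens_lact (a * b) (comul d)) 1).
  rewrite !comulE tens_bimod_sum.
  by apply: eq_bigr => i _; rewrite mulr1 [in RHS]mulrA.
rewrite comul_right tens_bimod_sum.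
by apply: eq_bigr => i _; rewrite mulr1 [in RHS]mulrA.
Qed.

(** Applying [f] to the second factor of [comul a] gives [a * phi f]. *)
Lemma comul_injective :
  (forall a, (forall f, a * phi f = 0) -> a = 0) -> injective comul.
Proof.
move=> phi_faithful; apply: raddf_inj => a a0; apply: phi_faithful => f.
pose contract (x y : A) : A := (f y : k) *: x.
have contract_bilinear : bilinear_for *:%R *:%R contract.
  split=> [y r u v|x r u v]; rewrite /contract.
    by rewrite scalerDr scalerA mulrC -scalerA.
  by rewrite linearD linearZ scalerDl -scalerA.
have := congr1 (tlift contract) a0; rewrite linear0 /comul linear_sum => <-.
rewrite [in LHS](dual_coord_sum f) linear_sum mulr_sumr; apply: eq_bigr => i _.
rewrite [RHS](tliftE contract_bilinear) linearZ /= /GRing.scale /=.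
rewrite mulr_algl /contract.
by rewrite -scalerAr.
Qed.

End Comultiplication.

(* Writing [Delta 1 = \sum_j x_j ⊗ y_j], both sides at [a] equal
   [\sum_i \sum_j x_j ⊗ (y_j * x_i) ⊗ (y_i * a)]. *)
Lemma bimodule_morphism_coassociative (Delta : {linear A -> (A ⊗ A)%type}) :
  bimodule_morphism Delta -> coassociative Delta.
Proof.
move=> bim a; pose n := \dim {:A}.
pose y (j : 'I_n) : A := (vbasis {:A})`_j.
have [x xE] : exists x : 'I_n -> A, Delta 1 = \sum_j x j ⊗ y j.
  exists (fun j => \sum_i (Delta 1 : 'M_(_, _)) i j *: y i).
  rewrite [LHS]tensor_sum exchange_big; apply: eq_bigr => j _.
  by rewrite linear_sumlz; apply: eq_bigr => i _; rewrite linearZl_LR.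
have DeltaE b d : Delta (b * d) = \sum_j (b * x j) ⊗ (y j * d).
  rewrite -[b]mulr1 bim xE tens_bimod_sum.
  by under [in RHS]eq_bigr do rewrite mulr1.
have DeltaE1 d : Delta d = \sum_j x j ⊗ (y j * d).
  by rewrite -[d]mul1r DeltaE mul1r; apply: eq_bigr => j _; rewrite mul1r.
transitivity (\sum_j \sum_i x j ⊗ ((y j * x i) ⊗ (y i * a))); last first.
  rewrite DeltaE1 tmap_sum; apply: eq_bigr => j _.
  by rewrite -linear_sumr -DeltaE (tmapE idfun Delta).
rewrite DeltaE1 tmap_sum tassoc_sum [RHS]exchange_big.
apply: eq_bigr => i _ /=.
rewrite (tmapE Delta idfun) DeltaE1 linear_sumlz tassoc_sum.
by apply: eq_bigr => j _; apply: tassocE.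
Qed.

End FiniteDimensionalAlgebra.

Theorem theorem0p1 (k : fieldType) (A : falgType k) (hA : self_injective A) :
  exists Delta : {linear A -> (A ⊗ A)%type},
    injective Delta /\ bimodule_morphism Delta /\ coassociative Delta.
Proof.
have [injA _] := hA; have [phi phi_faithful] := injective_dual_faithful_hom injA.
exists (comul phi); split; first exact: comul_injective.
split; first exact: comul_bimodule.
exact/bimodule_morphism_coassociative/comul_bimodule.
Qed.
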